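(* There exist $m_0\in\mathbb N$ and $\rho_0>0$ such that, for any $\kappa\in[\kappa_1,\kappa_2]$, the following hold: (i) $\max_{0\le n\le m_0}|\partial_\kappa^n\vec\Omega(\kappa)\cdot\ell|\ge\rho_0\langle\ell\rangle$ for all $\ell\in\mathbb Z^\nu\setminus\{0\}$; (ii) $\max_{0\le n\le m_0}|\partial_\kappa^n(\vec\Omega(\kappa)\cdot\ell+\Omega_j(\kappa))|\ge\rho_0\langle\ell\rangle$ for all $\ell\in\mathbb Z^\nu$, $j\in\mathbb S_0^c$ with $\vec\jmath\cdot\ell+j=0$; (iii) $\max_{0\le n\le m_0}|\partial_\kappa^n(\vec\Omega(\kappa)\cdot\ell+\Omega_j(\kappa)-\Omega_{j'}(\kappa))|\ge\rho_0\langle\ell\rangle$ for all $\ell\in\mathbb Z^\nu$, $j,j'\in\mathbb S_0^c$, $(\ell,j,j')\ne(0,j,j)$, with $\vec\jmath\cdot\ell+j-j'=0$; (iv) $\max_{0\le n\le m_0}|\partial_\kappa^n(\vec\Omega(\kappa)\cdot\ell+\Omega_j(\kappa)+\Omega_{j'}(\kappa))|\ge\rho_0\langle\ell\rangle$ for all $\ell\in\mathbb Z^\nu$, $j,j'\in\mathbb S_0^c$ with $\vec\jmath\cdot\ell+j+j'=0$.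
   Context: Fixed data: $g>0$, $\gamma\in\mathbb R$, $\mathtt h\in(0,+\infty]$, $0<\kappa_1<\kappa_2$. $G_j(0):=j\tanh(\mathtt h j)$ if $\mathtt h<\infty$, $G_j(0):=|j|$ if $\mathtt h=+\infty$. For $j\in\mathbb Z\setminus\{0\}$, $$\Omega_j(\kappa):=\sqrt{\Big(\kappa j^2+g+\frac{\gamma^2}{4}\frac{G_j(0)}{j^2}\Big)G_j(0)}+\frac\gamma2\frac{G_j(0)}{j}.$$ Fix integers $1\le\bar n_1<\dots<\bar n_\nu$ and signs $\sigma_a\in\{-1,1\}$; set $\bar\jmath_a:=\sigma_a\bar n_a$, $\mathbb S:=\{\bar\jmath_1,\dots,\bar\jmath_\nu\}$ (so the elements of $\mathbb S$ have pairwise distinct absolute values), $\vec\jmath:=(\bar\jmath_1,\dots,\bar\jmath_\nu)\in\mathbb Z^\nu$, $\mathbb S_0^c:=\mathbb Z\setminus(\mathbb S\cup\{0\})$, $\vec\Omega(\kappa):=(\Omega_{\bar\jmath_1}(\kappa),\dots,\Omega_{\bar\jmath_\nu}(\kappa))\in\mathbb R^\nu$. $\langle\ell\rangle:=\max\{1,|\ell|\}$. *)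

(* Defs.v *)
From HB Require Import structures.
From mathcomp Require Import all_boot all_order all_algebra.
From mathcomp Require Import all_classical all_reals all_analysis.

Set Implicit Arguments.
Unset Strict Implicit.
Unset Printing Implicit Defensive.

Import Order.TTheory GRing.Theory Num.Theory.
Import numFieldNormedType.Exports.

Local Open Scope classical_set_scope.
Local Open Scope ring_scope.

Definition tanh (R : realType) (x : R) : R :=
  (expR x - expR (- x)) / (expR x + expR (- x)).

(* The depth [h] lives in (0, +oo]; the value at [-oo] is never used. *)
Definition G0 (R : realType) (h : \bar R) (j : int) : R :=
  match h with
  | EFin h' => j%:~R * tanh (h' * j%:~R)
  | +oo%E => `|j%:~R|
  | -oo%E => 0
  end.

(* Meaningful for [j != 0] only. *)
Definition Omega (R : realType) (g gamma : R) (h : \bar R) (j : int)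
    (kappa : R) : R :=
  Num.sqrt ((kappa * j%:~R ^+ 2 + g
             + gamma ^+ 2 / 4 * (G0 h j / j%:~R ^+ 2)) * G0 h j)
  + gamma / 2 * (G0 h j / j%:~R).

Definition jbar (nu : nat) (nbar : 'I_nu -> nat) (sigma : 'I_nu -> int)
    (a : 'I_nu) : int :=
  sigma a * (nbar a)%:Z.

Definition tangential (nu : nat) (jv : 'I_nu -> int) : set int := range jv.

Definition normal0 (nu : nat) (jv : 'I_nu -> int) : set int :=
  ~` (tangential jv `|` [set 0]).

Definition momentum (nu : nat) (jv : 'I_nu -> int) (l : 'rV[int]_nu) : int :=
  \sum_(a < nu) jv a * l 0 a.

Definition OmegaDot (R : realType) (g gamma : R) (h : \bar R) (nu : nat)
    (jv : 'I_nu -> int) (l : 'rV[int]_nu) (kappa : R) : R :=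
  \sum_(a < nu) Omega g gamma h (jv a) kappa * (l 0 a)%:~R.

(* [max {1, |l|}] with the Euclidean norm. *)
Definition bracket (R : realType) (nu : nat) (l : 'rV[int]_nu) : R :=
  Num.max 1 (Num.sqrt (\sum_(a < nu) (l 0 a)%:~R ^+ 2)).

(* Since all terms are nonnegative, the default value 0 of the iterated
   maximum is harmless. *)
Definition maxderiv (R : realType) (m : nat) (f : R -> R) (kappa : R) : R :=
  \big[Num.max/0]_(n < m.+1) `|derive1n n f kappa|.

(* Main.v *)
Require Import Defs.
From HB Require Import structures.
From mathcomp Require Import all_boot all_order all_algebra.
From mathcomp Require Import all_classical all_reals all_analysis.
From mathcomp Require Import ring lra zify.

Set Implicit Arguments.
Unset Strict Implicit.
Unset Printing Implicit Defensive.

Import Order.TTheory GRing.Theory Num.Theory.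
Import numFieldNormedType.Exports.

Local Open Scope classical_set_scope.
Local Open Scope ring_scope.

(** The statement holds for a reason that needs no compactness argument: every
    frequency is an affine function of one square root,
      Omega_j(k) = w_n * sqrt (k + c_n) + constant,   n = |j|,
    where the shift c_n is strictly decreasing in n and the amplitude w_n is
    bounded below ([Omega_split], [disp_shift_decr], [disp_amp_ge]). The shift
    decreases because tanh (h n) is concave in n and vanishes at n = 0, so
    that tanh (h n) / n is nonincreasing.

    For n >= 1 the n-th derivative of sqrt (k + c) is a_n * s * u ^ n with
    s = sqrt (k + c), u = 1 / (k + c) and |a_n| >= 1/4. The first N derivatives
    of a combination of such roots are therefore, up to the factors a_n, the
    moments of a measure carried by the nodes u_i, and the additive constants
    disappear. Integrating a polynomial that vanishes at all the nodes but one
    isolates the weight of that node. The only loss comes from the distances between the nodes, which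
    are bounded below uniformly in j as soon as one of the two nodes belongs to
    the finite tangential set, because c is monotone. Hence
    ([net_coefficient_bound]) the sum of the integer coefficients of all the
    terms having a given |j| is at most C times the maximum of the derivatives,
    with C independent of l, j, j' and kappa.

    At a tangential site this sum differs from l_a by at most 2, so
    |l_a| <= 2 + C * max, and everything reduces to finding one isolated
    site whose net integer coefficient is nonzero, which gives 1 <= C * max
    ([combination_bound]). That is where momentum conservation enters
    ([nonresonant_index]): if all tangential coefficients cancel, then l is
    supported on the sites opposite to j and j', and the momentum relation
    says that j and e' * j' (where e' is 0, 1 or -1), each counted twice when
    its opposite is tangential, add up to zero; this leaves only the excluded trivial case or
    a surviving normal site. *)

(** * Derivatives of combinations of shifted square roots *)

(** The falling factorial of 1/2: the coefficient in
    d^n/dx^n sqrt x = half_falling n * x ^ (1/2 - n). *)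
Definition half_falling (R : realType) (n : nat) : R :=
  \prod_(k < n) (2^-1 - k%:R).

(** Only the factors 1/2 and -1/2 have absolute value below 1. *)
Lemma half_falling_ge (R : realType) (n : nat) :
  4^-1 <= `|half_falling R n.+1|.
Proof.
rewrite /half_falling; elim: n => [|[|n] IH].
- by rewrite big_ord1 subr0 gtr0_norm //; lra.
- by rewrite !big_ord_recr big_ord0 /= mul1r subr0 ltr0_norm //; lra.
rewrite big_ord_recr /= normrM.
suff h : 1 <= `|2^-1 - n.+2%:R :> R| by rewrite (le_trans IH)// ler_peMr.
have n0 := ler0n R n.
by rewrite -(addn2 n) natrD ler0_norm; lra.
Qed.

(** The derivatives are kept in the form (square root) * u ^ n with
    u = 1 / (x + c), so that successive orders become successive moments
    in u. *)
Lemma is_derive_sqrt_pow (R : realType) (c k : R) (n : nat) : 0 < k + c ->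
  is_derive k 1 (fun x : R => Num.sqrt (x + c) * (x + c)^-1 ^+ n)
    ((2^-1 - n%:R) * (Num.sqrt (k + c) * (k + c)^-1 ^+ n.+1)).
Proof.
move=> kc0.
have kc := lt0r_neq0 kc0.
have algebra (s u : R) : s * (n%:R * u ^+ n.-1 * (- u ^+ 2)) +
    u ^+ n * (2^-1 * s * u) = (2^-1 - n%:R) * (s * u ^+ n.+1).
  case: n => [|n] /=; first by rewrite !expr0; ring.
  by rewrite !exprS; ring.
have dc : is_derive k 1 (fun x : R => x + c) (1 : R).
  rewrite -[X in is_derive _ _ _ X]addr0.
  exact: (@is_deriveD _ _ _ id (cst c)).
have ds : is_derive k 1 (fun x => Num.sqrt (x + c)) ((2 * Num.sqrt (k + c))^-1).
  rewrite -[X in is_derive _ _ _ X]mulr1.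
  apply: (@is_derive1_comp _ Num.sqrt (fun x : R => x + c)).
  exact: is_derive1_sqrt.
have dv : is_derive k 1 (fun x => (x + c)^-1) (- (k + c) ^- 2).
  have := @is_deriveV _ (fun x => x + c) k 1 1 kc dc.
  by rewrite /GRing.scale /= mulr1.
have dX : is_derive k 1 (fun x => (x + c)^-1 ^+ n)
    (n%:R * (k + c)^-1 ^+ n.-1 * (- (k + c) ^- 2)).
  have := @is_deriveX _ _ (fun x => (x + c)^-1) n k 1 _ dv.
  by rewrite /GRing.scale /= exprfctE.
have := @is_deriveM _ _ _ _ _ _ _ _ ds dX.
rewrite mulrfctE; congr is_derive; rewrite /GRing.scale /=.
set s := Num.sqrt _; have s0 : s != 0 by rewrite gt_eqF ?sqrtr_gt0.
have sE : (2 * s)^-1 = 2^-1 * s * (k + c)^-1.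
  by rewrite -[k + c]sqr_sqrtr ?ltW// -/s; field; rewrite s0.
rewrite sE -exprVn; exact: algebra.
Qed.

Lemma derive1n_sqrt_comb (R : realType) (I : finType) (e : R) (A c : I -> R)
    (n : nat) (k : R) : 0 < k -> (forall i, 0 <= c i) ->
  derive1n n.+1 (fun x => e + \sum_i A i * Num.sqrt (x + c i)) k =
  half_falling R n.+1 *
    \sum_i A i * (Num.sqrt (k + c i) * (k + c i)^-1 ^+ n.+1).
Proof.
move=> k0 c0.
have term (m : nat) (x : R) : 0 < x ->
    is_derive x 1
      (fun y => \sum_i A i * (Num.sqrt (y + c i) * (y + c i)^-1 ^+ m))
      ((2^-1 - m%:R) *
       \sum_i A i * (Num.sqrt (x + c i) * (x + c i)^-1 ^+ m.+1)).
  move=> x0; rewrite mulr_sumr -fct_sumE.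
  elim/big_ind2 : _ => [|f df g dg hf hg|i _].
  - exact: is_derive_cst.
  - exact: is_deriveD.
  rewrite mulrCA; apply: is_deriveZ; apply: is_derive_sqrt_pow.
  by rewrite ltr_pwDl.
elim: n k k0 => [|n IH] k k0.
  rewrite /derive1n /= derive1E; apply: derive_val.
  rewrite -[X in is_derive _ _ _ X]add0r.
  apply: (@is_deriveD _ _ _ (cst e)
    (fun x : R => \sum_i A i * Num.sqrt (x + c i))).
  have := term 0%N k k0; rewrite /half_falling big_ord1 subr0.
  congr is_derive; apply/funext => x; apply: eq_bigr => i _.
  by rewrite expr0 mulr1.
rewrite [LHS]/= derive1E -/(derive1n n.+1 _).
(* The inductive formula is only valid for positive arguments, hence the passage
   through equality near k. *)
pose G (x : R) := half_falling R n.+1 *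
  \sum_i A i * (Num.sqrt (x + c i) * (x + c i)^-1 ^+ n.+1).
rewrite (@near_eq_derive _ _ _ _ G) ?oner_eq0//; last first.
  near=> x; apply: IH; near: x.
  exact: lt_nbhsr.
apply: derive_val.
rewrite /half_falling big_ord_recr/= -mulrA -/(half_falling R n.+1).
by apply: is_deriveZ; apply: term.
Unshelve. all: by end_near. Qed.

Lemma derive1n_le_maxderiv (R : realType) (m n : nat) (f : R -> R) (k : R) :
  (n <= m)%N -> `|derive1n n f k| <= maxderiv m f k.
Proof.
move=> nm; rewrite /maxderiv.
exact: (@le_bigmax _ _ _ _ (fun i : 'I_m.+1 => `|derive1n i f k|)
  (Ordinal (nm : (n < m.+1)%N))).
Qed.

(** * Isolating one node *)

(** A bound on the moments of orders 1 to N of the weights b at the nodes u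
    gives a bound on the moments of b weighted by a product of factors u - v.
    Each factor costs one order and multiplies the bound by at most 1 + U: the
    new moment of order n is the old one of order n.+1 minus v times the old
    one of order n. *)
Lemma node_filter_le (R : realType) (I : finType) (b u : I -> R) (U B : R)
    (N : nat) (l : seq R) (n : nat) :
  0 <= U -> {in l, forall v, `|v| <= U} ->
  (forall m, (0 < m <= N)%N -> `|\sum_i b i * u i ^+ m| <= B) ->
  (0 < n)%N -> (n + size l <= N)%N ->
  `|\sum_i b i * u i ^+ n * \prod_(v <- l) (u i - v)|
    <= (1 + U) ^+ size l * B.
Proof.
move=> U0 + hB; elim: l n => [|v l IH] n /= hl n0 nN.
  rewrite mul1r; under eq_bigr do rewrite big_nil mulr1.
  by apply: hB; rewrite n0 -(addn0 n).
have {}IH m := IH m (fun w wl => hl w (mem_behead (s := v :: l) wl)).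
have -> : \sum_i b i * u i ^+ n * \prod_(w <- v :: l) (u i - w) =
    \sum_i b i * u i ^+ n.+1 * \prod_(w <- l) (u i - w)
    - v * \sum_i b i * u i ^+ n * \prod_(w <- l) (u i - w).
  rewrite mulr_sumr -sumrB; apply: eq_bigr => i _.
  by rewrite big_cons exprS; ring.
rewrite (le_trans (ler_normB _ _))// exprS -mulrA mulrDl mul1r lerD//.
  by apply: IH => //; rewrite addSnnS.
rewrite normrM ler_pM ?hl ?mem_head//.
by apply: IH => //; rewrite (leq_trans _ nN)// leq_add2l.
Qed.

(** The filter of [node_filter_le] is used with factors that vanish at all the
    nodes whose shift differs from that of i0. The hypothesis on delta keeps the
    filter away from 0 at the node of i0, so that C depends on the number of
    terms but on neither their shifts nor their coefficients. *)
Lemma separated_node_bound (R : realType) (I : finType)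
    (kappa1 kappa2 cmax delta : R) :
  0 < kappa1 -> kappa1 <= kappa2 -> 0 <= cmax -> 0 < delta ->
  exists2 C : R, 0 < C &
    forall (e : R) (A c : I -> R) (i0 : I) (kappa : R),
      (forall i, 0 <= c i <= cmax) ->
      (forall i, c i != c i0 -> delta <= `|c i - c i0|) ->
      kappa1 <= kappa <= kappa2 ->
      `|\sum_(i | c i == c i0) A i| <=
        C * maxderiv #|I|.+1
              (fun x => e + \sum_i A i * Num.sqrt (x + c i)) kappa.
Proof.
move=> k10 k12 cm0 d0.
pose U := kappa1^-1; pose um := (kappa2 + cmax)^-1.
have um0 : 0 < um by rewrite invr_gt0; lra.
(* Lower bound for each factor of the filter at the isolated node: u itself, or
   a difference of nodes u - u' = (c' - c) * u * u'. *)
pose th := Num.min um (delta * um ^+ 2).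
have th0 : 0 < th by rewrite lt_min um0 mulr_gt0// exprn_gt0.
have U0 : 0 < U by rewrite invr_gt0.
pose D := Num.sqrt kappa1 * um * th ^+ #|I|.
have D0 : 0 < D by rewrite !mulr_gt0 ?exprn_gt0// sqrtr_gt0.
exists ((1 + U) ^+ #|I| * 4 / D).
  by rewrite !mulr_gt0 ?invr_gt0 ?exprn_gt0//; lra.
move=> e A c i0 k hc hd /andP[k1k kk2].
set M := maxderiv _ _ _.
pose u i := (k + c i)^-1.
have kc_bounds i : kappa1 <= k + c i <= kappa2 + cmax.
  by have /andP[? ?] := hc i; apply/andP; split; lra.
have kc_gt0 i : 0 < k + c i.
  by have /andP[h _] := kc_bounds i; exact: lt_le_trans h.
have u_gt0 i : 0 < u i by rewrite invr_gt0.
have u_le i : u i <= U.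
  by rewrite lef_pV2 ?posrE//; have /andP[] := kc_bounds i.
have u_ge i : um <= u i.
  by rewrite lef_pV2 ?posrE//; [have /andP[] := kc_bounds i | lra].
pose b i := A i * Num.sqrt (k + c i).
(* Terms sharing the shift of i0 get the harmless factor u - 0, which makes the
   degree of the filter the same for all families. *)
pose v i := if c i == c i0 then 0 else u i.
have hB m : (0 < m <= #|I|.+1)%N -> `|\sum_i b i * u i ^+ m| <= 4 * M.
  case: m => // m /andP[_ mI].
  have k0 : 0 < k by exact: lt_le_trans k1k.
  pose S := \sum_i A i * (Num.sqrt (k + c i) * (k + c i)^-1 ^+ m.+1).
  have -> : \sum_i b i * u i ^+ m.+1 = S.
    by apply: eq_bigr => i _; rewrite mulrA.
  have := derive1n_le_maxderiv
    (fun x => e + \sum_i A i * Num.sqrt (x + c i)) k mI.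
  rewrite derive1n_sqrt_comb//; last by move=> i; have /andP[] := hc i.
  rewrite -/S normrM -/M => hM.
  have := le_trans (ler_wpM2r (normr_ge0 S) (half_falling_ge R m)) hM; lra.
have hl : {in [seq v i | i <- enum I], forall w, `|w| <= U}.
  move=> w /mapP[i _ ->]; rewrite /v; case: ifP => _.
    by rewrite normr0 ltW.
  by rewrite gtr0_norm.
have sz : size [seq v i | i <- enum I] = #|I| by rewrite size_map cardE.
have := @node_filter_le _ I b u U (4 * M) #|I|.+1 _ 1%N (ltW U0) hl hB isT.
rewrite sz add1n leqnn => /(_ isT).
under eq_bigr => i _ do rewrite big_map big_enum /=.
set P := \prod_(j | j \in I) (u i0 - v j).
have -> : \sum_i b i * u i ^+ 1 * \prod_(j | j \in I) (u i - v j) =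
    (\sum_(i | c i == c i0) A i) * (Num.sqrt (k + c i0) * u i0 * P).
  rewrite mulr_suml [RHS]big_mkcond; apply: eq_bigr => i _; case: ifP => ci.
    by rewrite /b /P /u (eqP ci) expr1 !mulrA.
  rewrite (bigD1 i)//= /v ci subrr; ring.
have hP : th ^+ #|I| <= `|P|.
  rewrite normr_prod -prodr_const; apply: ler_prod => j _.
  rewrite ltW//= /v; case: ifPn => cj.
    by rewrite subr0 gtr0_norm// (le_trans _ (u_ge i0))// ge_min lexx.
  have -> : u i0 - u j = (c j - c i0) * (u i0 * u j).
    by rewrite /u; field; rewrite !gt_eqF.
  rewrite normrM [X in _ * X]gtr0_norm ?mulr_gt0//.
  rewrite ge_min; apply/orP; right.
  apply: ler_pM; rewrite ?hd ?exprn_ge0 ?(ltW d0) ?(ltW um0)//.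
  by rewrite expr2 ler_pM ?(ltW um0).
rewrite normrM => hS.
rewrite mulrAC ler_pdivlMr// -(mulrA _ 4); apply: le_trans hS.
apply: ler_wpM2l => //; rewrite normrM gtr0_norm; last first.
  by rewrite mulr_gt0// sqrtr_gt0.
apply: ler_pM => //; rewrite ?exprn_ge0 ?(ltW th0)//.
  by rewrite mulr_ge0 ?sqrtr_ge0 ?ltW.
apply: ler_pM => //; rewrite ?sqrtr_ge0 ?(ltW um0)// ler_wsqrtr//.
by have /andP[] := kc_bounds i0.
Qed.

(** * The dispersion relation *)

Lemma tanhN (R : realType) (x : R) : tanh (- x) = - tanh x.
Proof. by rewrite /tanh opprK -mulNr opprB [X in _ / X]addrC. Qed.

(** In terms of q = exp (2 h), the sequence tanh (h n) is rational in q ^ n. *)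
Lemma tanh_natE (R : realType) (h : R) (n : nat) :
  tanh (h * n%:R) = 1 - 2 / (expR (2 * h) ^+ n + 1).
Proof.
have -> : expR (2 * h) ^+ n = expR (h * n%:R) ^+ 2.
  by rewrite -!expRM_natl; congr expR; ring.
rewrite /tanh expRN; set y := expR _; have y0 : 0 < y by exact: expR_gt0.
have y1 : 0 < y ^+ 2 + 1 by rewrite ltr_wpDl ?exprn_ge0 ?ltW.
by field; rewrite !gt_eqF.
Qed.

(** Chords from the origin of a concave sequence have decreasing slopes. *)
Lemma concave_seq_ratio (R : realType) (T : nat -> R) : 0 <= T 0%N ->
  (forall n, T n.+2 - T n.+1 <= T n.+1 - T n) ->
  forall n, n%:R * T n.+1 <= n.+1%:R * T n.
Proof.
move=> T0 hT; elim=> [|n IH]; first by rewrite mul0r mul1r.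
have := ler_wpM2l (ler0n R n.+1) (hT n).
by move: IH; rewrite -!natr1; lra.
Qed.

Lemma tanh_nat_concave (R : realType) (h : R) (n : nat) : 0 < h ->
  tanh (h * n.+2%:R) - tanh (h * n.+1%:R)
    <= tanh (h * n.+1%:R) - tanh (h * n%:R).
Proof.
move=> h0; rewrite !tanh_natE !exprS.
set q := expR _; have q1 : 1 < q by rewrite expR_gt1; lra.
set y := q ^+ n; have y1 : 1 <= y by rewrite exprn_ege1// ltW.
have yq : 1 < q * y by apply: (lt_le_trans q1); rewrite ler_peMr//; lra.
have yqq : 1 < q * (q * y) by apply: (lt_trans q1); rewrite ltr_pMr//; lra.
(* The second difference of y |-> 2 / (y + 1) along y, q y, q ^ 2 y. *)
pose gap := 2 * y * (q - 1) ^+ 2 * (q * y - 1)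
  / ((y + 1) * (q * y + 1) * (q * (q * y) + 1)).
have gapE : 2 / (y + 1) - 2 / (q * y + 1)
    - (2 / (q * y + 1) - 2 / (q * (q * y) + 1)) = gap.
  by rewrite /gap; field; rewrite !gt_eqF//; lra.
suff : 0 <= gap by rewrite -gapE; lra.
by rewrite /gap divr_ge0 ?mulr_ge0 ?exprn_ge0//; lra.
Qed.

Lemma tanh_nat_gt0 (R : realType) (h : R) (n : nat) : 0 < h ->
  0 < tanh (h * n.+1%:R).
Proof.
move=> h0; rewrite tanh_natE; set q := expR _.
have q1 : 1 < q by rewrite expR_gt1; lra.
have y1 : 1 < q ^+ n.+1 by rewrite exprn_egt1.
by rewrite subr_gt0 ltr_pdivrMr; lra.
Qed.

Lemma tanh_nat_le (R : realType) (h : R) (n : nat) : 0 < h ->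
  tanh (h * 1%:R) <= tanh (h * n.+1%:R).
Proof.
move=> h0; rewrite !tanh_natE; set q := expR _.
have q1 : 1 < q by rewrite expR_gt1; lra.
have qn : q <= q ^+ n.+1 by rewrite -[leLHS]expr1 ler_weXn2l// ltW.
rewrite expr1 lerB// ler_pM2l// lef_pV2 ?posrE; lra.
Qed.

Lemma G0_abs (R : realType) (h : \bar R) (j : int) : G0 h j = G0 h `|j|%N%:Z.
Proof.
rewrite abszE; case: (leP 0 j) => [j0|j0]; first by rewrite ger0_norm.
rewrite ltr0_norm//; case: h => [h| |] //=.
  by rewrite mulrNz mulrN tanhN mulrNN.
by rewrite mulrNz normrN.
Qed.

Lemma G0_gt0 (R : realType) (h : \bar R) (n : nat) : (0 < h)%E ->
  0 < G0 h n.+1%:Z.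
Proof.
case: h => [h| |] //=; rewrite ?lte_fin -pmulrn => h0.
  by rewrite mulr_gt0// tanh_nat_gt0.
by rewrite normr_gt0 pnatr_eq0.
Qed.

Lemma G0_ge (R : realType) (h : \bar R) (n : nat) : (0 < h)%E ->
  G0 h 1%:Z <= G0 h n.+1%:Z.
Proof.
case: h => [h| |] //=; rewrite ?lte_fin -?pmulrn => h0.
  by rewrite ler_pM ?tanh_nat_le ?ler1n//; exact/ltW/tanh_nat_gt0.
by rewrite !ger0_norm// ler1n.
Qed.

(** For finite depth this ratio is tanh (h n) / n, a chord slope of a concave
    sequence. *)
Lemma G0_ratio_decr (R : realType) (h : \bar R) (n : nat) : (0 < h)%E ->
  G0 h n.+2%:Z / n.+2%:R ^+ 2 <= G0 h n.+1%:Z / n.+1%:R ^+ 2.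
Proof.
case: h => [h| |] //=; rewrite ?lte_fin -!pmulrn => h0; last first.
  rewrite !ger0_norm// !expr2 !invfM !mulVKf ?pnatr_eq0//.
  by rewrite lef_pV2 ?posrE// ler_nat.
have ratioE (m : nat) (t : R) :
    m.+1%:R * t / m.+1%:R ^+ 2 = t / m.+1%:R.
  by have : m.+1%:R != 0 :> R by [rewrite pnatr_eq0]; move=> m0; field.
rewrite !ratioE.
rewrite ler_pdivrMr// mulrAC ler_pdivlMr// ![tanh _ * _]mulrC.
apply: (@concave_seq_ratio _ (fun n => tanh (h * n%:R))) => [|m].
  by rewrite mulr0 /tanh oppr0 subrr mul0r.
exact: tanh_nat_concave.
Qed.

(** Factoring w_n ^ 2 = n ^ 2 * G_n out of the radicand of Omega_j leaves
    kappa + c_n; [disp_shift] is c_n and [disp_amp] is w_n. *)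
Definition disp_shift (R : realType) (g gamma : R) (h : \bar R) (n : nat) : R :=
  (g + gamma ^+ 2 / 4 * (G0 h n%:Z / n%:R ^+ 2)) / n%:R ^+ 2.

Definition disp_amp (R : realType) (h : \bar R) (n : nat) : R :=
  Num.sqrt (n%:R ^+ 2 * G0 h n%:Z).

Lemma Omega_split (R : realType) (g gamma : R) (h : \bar R) (j : int) (k : R) :
  (0 < h)%E -> j != 0 ->
  Omega g gamma h j k =
  disp_amp h `|j|%N * Num.sqrt (k + disp_shift g gamma h `|j|%N)
  + gamma / 2 * (G0 h j / j%:~R).
Proof.
move=> h0 j0; rewrite /Omega /disp_amp /disp_shift; congr (_ + _).
have -> : j%:~R ^+ 2 = `|j|%N%:R ^+ 2 :> R.
  by rewrite pmulrn abszE intr_norm real_normK ?num_real.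
rewrite G0_abs; have : (0 < `|j|)%N by rewrite absz_gt0.
case: `|j|%N => // n _.
have G0n := G0_gt0 n h0.
rewrite -sqrtrM ?mulr_ge0 ?exprn_ge0 ?(ltW G0n)//; congr Num.sqrt.
have : n.+1%:R != 0 :> R by rewrite pnatr_eq0.
by move=> n0; field.
Qed.

(** The contribution of g decreases strictly, and that of gamma does not
    increase by [G0_ratio_decr]. *)
Lemma disp_shift_decr (R : realType) (g gamma : R) (h : \bar R) (m n : nat) :
  0 < g -> (0 < h)%E -> (0 < m < n)%N ->
  disp_shift g gamma h n < disp_shift g gamma h m.
Proof.
move=> g0 h0 /andP[m0 mn].
suff step i : disp_shift g gamma h i.+2 < disp_shift g gamma h i.+1.
  case: m m0 mn => // m _; case: n => // n; rewrite ltnS.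
  elim: n => // n IH; rewrite ltnS leq_eqVlt => /predU1P[->//|/IH].
  exact: lt_trans.
have hG := G0_ratio_decr i h0.
have hG1 : 0 < G0 h i.+2%:Z / i.+2%:R ^+ 2 by rewrite divr_gt0 ?G0_gt0.
have g4 : 0 <= gamma ^+ 2 / 4 by rewrite divr_ge0// sqr_ge0.
have sq0 (p : nat) : 0 < p.+1%:R ^+ 2 :> R by rewrite exprn_gt0.
rewrite /disp_shift; apply: (@le_lt_trans _ _
  ((g + gamma ^+ 2 / 4 * (G0 h i.+1%:Z / i.+1%:R ^+ 2)) / i.+2%:R ^+ 2)).
  by rewrite ler_pM2r ?invr_gt0// lerD2l ler_wpM2l.
rewrite ltr_pM2l; first by rewrite ltf_pV2 ?posrE// ltr_pXn2r ?nnegrE// ltr_nat.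
by rewrite ltr_pwDl// mulr_ge0// (le_trans _ hG)// ltW.
Qed.

Lemma disp_shift_bounds (R : realType) (g gamma : R) (h : \bar R) (n : nat) :
  0 < g -> (0 < h)%E ->
  0 <= disp_shift g gamma h n.+1 <= disp_shift g gamma h 1.
Proof.
move=> g0 h0; apply/andP; split.
  rewrite divr_ge0 ?exprn_ge0// addr_ge0 ?(ltW g0)// mulr_ge0//.
    by rewrite divr_ge0// sqr_ge0.
  by rewrite divr_ge0 ?exprn_ge0// ltW// G0_gt0.
by case: n => // n; rewrite ltW// disp_shift_decr.
Qed.

Lemma disp_amp_ge (R : realType) (h : \bar R) (n : nat) : (0 < h)%E ->
  disp_amp h 1 <= disp_amp h n.+1.
Proof.
move=> h0; rewrite ler_wsqrtr// ler_pM ?G0_ge//; first exact/ltW/G0_gt0.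
by rewrite expr1n exprn_ege1// ler1n.
Qed.

Lemma disp_amp_gt0 (R : realType) (h : \bar R) : (0 < h)%E -> 0 < disp_amp h 1.
Proof. by move=> h0; rewrite sqrtr_gt0 mulr_gt0 ?G0_gt0// exprn_gt0. Qed.

(** * Bounding the net coefficient of a site *)

(** By monotonicity, the value of c closest to c m is attained at a neighbour
    of m, so the consecutive gaps up to rank P suffice, however large n is. *)
Lemma decreasing_seq_separated (R : realType) (c : nat -> R) (P : nat) :
  (forall m n, (0 < m < n)%N -> c n < c m) ->
  exists2 delta : R, 0 < delta &
    forall m n, (0 < m <= P)%N -> (0 < n)%N -> n != m -> delta <= `|c n - c m|.
Proof.
move=> decr.
have decrW m n : (0 < m)%N -> (m <= n)%N -> c n <= c m.
  move=> m0; rewrite leq_eqVlt => /predU1P[->//|mn].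
  by rewrite ltW// decr// m0.
have [delta d0 hd] : exists2 delta : R, 0 < delta &
    forall i, (0 < i <= P)%N -> delta <= c i - c i.+1.
  elim: P => [|P [d d0 hd]].
    by exists 1 => // i /andP[i0]; rewrite leqNgt i0.
  exists (Num.min d (c P.+1 - c P.+2)).
    by rewrite lt_min d0 subr_gt0 decr//= ltnSn.
  move=> i /andP[i0]; rewrite leq_eqVlt => /predU1P[->|iP].
    by rewrite ge_min lexx orbT.
  by rewrite ge_min hd// i0.
exists delta => // m n /andP[m0 mP] n0; rewrite neq_ltn => /orP[nm|mn].
  have nP : (0 < n <= P)%N by rewrite n0 (leq_trans _ mP)// ltnW.
  rewrite (le_trans (hd _ nP))// (le_trans _ (ler_norm _))// lerD2l lerN2.
  exact: decrW.
rewrite distrC (le_trans (hd m _)) ?m0// (le_trans _ (ler_norm _))//.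
by rewrite lerD2l lerN2 decrW.
Qed.

(** The separation of the shifts fails for pairs of large indices, since c_n
    converges. It is uniform when one index of the pair lies in the fixed
    list T, whence the hypothesis on i0. *)
Lemma net_coefficient_bound (R : realType) (g gamma : R) (h : \bar R)
    (kappa1 kappa2 : R) (I : finType) (T : seq nat) :
  0 < g -> (0 < h)%E -> 0 < kappa1 -> kappa1 <= kappa2 ->
  exists2 C : R, 0 < C &
    forall (e : R) (k : I -> int) (n : I -> nat) (i0 : I) (kappa : R),
      (forall i, (0 < n i)%N) ->
      (forall i, [\/ n i = n i0, n i0 \in T | n i \in T]) ->
      kappa1 <= kappa <= kappa2 ->
      `|\sum_(i | n i == n i0) k i|%:~R <=
        C * maxderiv #|I|.+1 (fun x => e + \sum_i (k i)%:~R *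
              (disp_amp h (n i)
               * Num.sqrt (x + disp_shift g gamma h (n i)))) kappa.
Proof.
move=> g0 h0 k10 k12.
have decr m n := @disp_shift_decr _ g gamma h m n g0 h0.
have [delta d0 hd] := decreasing_seq_separated (\max_(t <- T) t) decr.
have hT (t : nat) : t \in T -> (t <= \max_(t <- T) t)%N.
  by move=> tT; exact: (@leq_bigmax_seq _ T xpredT id t).
have sh1 : 0 <= disp_shift g gamma h 1.
  by have /andP[] := @disp_shift_bounds _ g gamma h 0 g0 h0.
have [C C0 hC] := separated_node_bound I k10 k12 sh1 d0.
exists (C / disp_amp h 1); first by rewrite divr_gt0 ?disp_amp_gt0.
move=> e k n i0 kappa n0 sep hk.
have sepn i : n i != n i0 ->
    delta <= `|disp_shift g gamma h (n i) - disp_shift g gamma h (n i0)|.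
  move=> ni; case: (sep i) => [E|iT|iT].
  - by rewrite E eqxx in ni.
  - by rewrite hd ?n0// hT.
  - by rewrite distrC hd ?n0// 1?eq_sym// hT.
have shiftE i :
    (disp_shift g gamma h (n i) == disp_shift g gamma h (n i0)) = (n i == n i0).
  apply/idP/idP => [|/eqP->//]; apply: contraTT => /sepn.
  by move=> /(lt_le_trans d0); rewrite normr_gt0 subr_eq0.
have := hC e (fun i => (k i)%:~R * disp_amp h (n i))
  (fun i => disp_shift g gamma h (n i)) i0 kappa _ _ hk.
have -> : \sum_(i | disp_shift g gamma h (n i) == disp_shift g gamma h (n i0))
      (k i)%:~R * disp_amp h (n i) =
    (\sum_(i | n i == n i0) k i)%:~R * disp_amp h (n i0).
  rewrite mulrz_sumr mulr_suml; apply: eq_big => [i|i]; rewrite shiftE//.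
  by move=> /eqP->.
under [X in maxderiv _ X _]eq_fun do under eq_bigr do rewrite -mulrA.
move=> H; rewrite mulrAC ler_pdivlMr ?disp_amp_gt0//; apply: le_trans (H _ _).
- rewrite normrM intr_norm ler_wpM2l// (le_trans _ (ler_norm _))//.
  by case: (n i0) (n0 i0) => // m _; exact: disp_amp_ge.
- by move=> i; case: (n i) (n0 i) => // m _; exact: disp_shift_bounds.
- by move=> i; rewrite shiftE; exact: sepn.
Qed.

(** * Integer combinations of frequencies *)

(** The terms of l . Omega + e Omega_j + e' Omega_j' are indexed by
    'I_nu + bool, with [inr true] standing for j and [inr false] for j'. Only
    the absolute value of a site matters up to additive constants, so terms are
    grouped according to it. *)
Definition term_site (nu : nat) (jv : 'I_nu -> int) (j j' : int)
    (i : 'I_nu + bool) : int :=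
  match i with inl a => jv a | inr b => if b then j else j' end.

Definition term_coef (nu : nat) (l : 'rV[int]_nu) (e e' : int)
    (i : 'I_nu + bool) : int :=
  match i with inl a => l 0 a | inr b => if b then e else e' end.

Definition net_coef (nu : nat) (jv : 'I_nu -> int) (l : 'rV[int]_nu)
    (e e' j j' : int) (n : nat) : int :=
  \sum_(i | `|term_site jv j j' i|%N == n) term_coef l e e' i.

(** The condition under which [net_coefficient_bound] applies to the term i0,
    T being the set of absolute values of the tangential sites. *)
Definition isolated_term (nu : nat) (jv : 'I_nu -> int) (j j' : int)
    (i0 : 'I_nu + bool) : Prop :=
  forall i, [\/ `|term_site jv j j' i|%N = `|term_site jv j j' i0|%N,
    `|term_site jv j j' i0|%N \in codom (fun a => `|jv a|%N) |
    `|term_site jv j j' i|%N \in codom (fun a => `|jv a|%N)].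

Lemma net_coefE (nu : nat) (jv : 'I_nu -> int) (l : 'rV[int]_nu)
    (e e' j j' : int) (n : nat) :
  net_coef jv l e e' j j' n =
  \sum_(a | `|jv a|%N == n) l 0 a
  + ((if `|j|%N == n then e else 0) + (if `|j'|%N == n then e' else 0)).
Proof.
by rewrite /net_coef big_sumType/=; congr (_ + _); rewrite big_mkcond big_bool.
Qed.

Lemma net_coef_site (nu : nat) (jv : 'I_nu -> int) (l : 'rV[int]_nu)
    (e e' j j' : int) (a : 'I_nu) :
  injective (fun a => `|jv a|%N) ->
  net_coef jv l e e' j j' `|jv a|%N =
  l 0 a + ((if `|j|%N == `|jv a|%N then e else 0)
           + (if `|j'|%N == `|jv a|%N then e' else 0)).
Proof.
move=> inj; rewrite net_coefE; congr (_ + _).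
by rewrite (big_pred1 a)// => b /=; rewrite -(inj_eq inj).
Qed.

Lemma bracket_le (R : realType) (nu : nat) (l : 'rV[int]_nu) (K : R) :
  (0 < nu)%N -> 1 <= K -> (forall a, `|l 0 a|%:~R <= K) ->
  bracket R l <= nu%:R * K.
Proof.
move=> nu0 K1 hK; have K0 : 0 <= K by lra.
have nu1 : 1 <= nu%:R :> R by rewrite ler1n.
rewrite /bracket ge_max; apply/andP; split.
  by rewrite -[leLHS]mulr1 ler_pM.
rewrite -[leRHS]ger0_norm ?mulr_ge0// -sqrtr_sqr ler_wsqrtr//.
apply: (@le_trans _ _ (\sum_(a < nu) K ^+ 2)).
  apply: ler_sum => a _; rewrite -real_normK ?num_real// -intr_norm.
  by rewrite ler_pXn2r ?nnegrE// ler0z.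
rewrite sumr_const card_ord -[K ^+ 2 *+ _]mulr_natl exprMn.
rewrite ler_wpM2r ?exprn_ge0//.
by rewrite expr2 ler_peMr.
Qed.

(** * Momentum conservation and the lower bound *)

(** If every tangential net coefficient vanishes, l is determined by j and j',
    and a normal site with tangential absolute value is the opposite of a
    tangential site. Momentum conservation then reads
    j * (1 + [|j| in T]) + e' * j' * (1 + [|j'| in T]) = 0.
    For e' = 0 this contradicts j != 0. Otherwise, if exactly one of |j|, |j'| is
    in T, the other one carries the surviving term. If none or both are in T,
    then j = - e' * j'. For e' = -1 this forces l = 0, which is excluded; for
    e' = 1 the net coefficient at |j| is 2 if |j| is outside T, whereas inside T
    the same tangential site would be opposite to both j and - j. *)
Lemma nonresonant_index (nu : nat) (jv : 'I_nu -> int) (l : 'rV[int]_nu)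
    (j j' e' : int) :
  injective (fun a => `|jv a|%N) -> normal0 jv j -> normal0 jv j' ->
  e' \in [:: 0; 1; -1] -> (e' = -1 -> j = j' -> l <> 0) ->
  momentum jv l + j + e' * j' = 0 ->
  exists2 i0, isolated_term jv j j' i0 &
    net_coef jv l 1 e' j j' `|term_site jv j j' i0|%N != 0.
Proof.
move=> inj nj nj' he' hl mom.
pose T := codom (fun a => `|jv a|%N).
have [[a ha]|/forallNP net0] :=
    pselect (exists a, net_coef jv l 1 e' j j' `|jv a|%N != 0).
  by exists (inl a) => // i; apply: Or32; exact: codom_f.
have lE a : l 0 a = - ((if `|j|%N == `|jv a|%N then 1 else 0)
           + (if `|j'|%N == `|jv a|%N then e' else 0)).
  by apply/eqP; rewrite -addr_eq0 -net_coef_site//; apply/negPn/negP/net0.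
have normal_site n a : normal0 jv n -> `|n|%N = `|jv a|%N -> jv a = - n.
  move=> nn na; have nja : jv a != n.
    by apply/eqP => jn; apply: nn; left; exists a.
  by lia.
have sumE n (c : int) : normal0 jv n ->
    \sum_a jv a * (if `|n|%N == `|jv a|%N then c else 0) =
    - ((`|n|%N \in T)%:R * (c * n)).
  move=> nn; have [/codomP[a na]|nT] := boolP (`|n|%N \in T).
    rewrite (bigD1 a)//= big1 => [|b ba].
      by rewrite na eqxx (normal_site n a nn na) addr0 mul1r mulNr mulrC.
    rewrite na; case: eqP => [ab|_]; last by rewrite mulr0.
    by rewrite (inj _ _ ab) eqxx in ba.
  rewrite mul0r oppr0 big1// => a _; case: eqP => [na|]; last by rewrite mulr0.
  by case/negP: nT; rewrite na codom_f.
have momE : momentum jv l =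
    (`|j|%N \in T)%:R * (1 * j) + (`|j'|%N \in T)%:R * (e' * j').
  rewrite -[LHS]opprK /momentum -sumrN.
  under eq_bigr => a _ do rewrite lE mulrN opprK mulrDr.
  by rewrite big_split /= !sumE// -opprD opprK.
have j0 : j != 0 by apply/eqP => h; apply: nj; right.
have j'0 : j' != 0 by apply/eqP => h; apply: nj'; right.
have l0 : e' = -1 -> j != j'.
  move=> e1; apply/eqP => jj; apply: (hl e1 jj); apply/rowP => a.
  by rewrite lE jj e1 mxE; case: eqP => _.
have netE n : n \notin T -> net_coef jv l 1 e' j j' n =
    (if `|j|%N == n then 1 else 0) + (if `|j'|%N == n then e' else 0).
  move=> nT; rewrite net_coefE big1 ?add0r// => a /eqP an.
  by case/negP: nT; rewrite -an codom_f.
have sep (b : bool) : `|if b then j' else j|%N \in T \/ `|j|%N = `|j'|%N ->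
   isolated_term jv j j' (inr b).
  move=> hb [a|c]; first by apply: Or33; exact: codom_f.
  case: hb => [bT|jj]; last by apply: Or31; case: c b => [] [].
  case: c b bT => [] [] /= bT.
  - exact: Or31.
  - exact: Or33.
  - exact: Or33.
  - exact: Or31.
rewrite momE in mom.
have [jT|jT] := boolP (`|j|%N \in T); have [j'T|j'T] := boolP (`|j'|%N \in T).
- exfalso; move: mom he' l0; rewrite jT j'T !inE => mom.
  case/or3P => /eqP e1; rewrite e1 in mom *; last 1 first.
  + by move=> /(_ erefl); lia.
  + by move=> _; lia.
  move=> _; have jj : j' = - j by lia.
  case/codomP: jT => a ja; have := normal_site j a nj ja.
  have ja' : `|j'|%N = `|jv a|%N by rewrite jj abszN.
  by have := normal_site j' a nj' ja'; lia.
- have [e0|e0] := eqVneq e' 0.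
    by exfalso; move: mom; rewrite jT (negPf j'T) e0; lia.
  exists (inr false) => /=; first by apply: sep; left.
  rewrite netE// eqxx ifF ?add0r//; apply/negP => /eqP jj.
  by rewrite -jj jT in j'T.
- exists (inr true) => /=; first by apply: sep; left.
  rewrite netE// eqxx ifF ?addr0//; apply/negP => /eqP jj.
  by rewrite -jj j'T in jT.
move: mom he' l0; rewrite (negPf jT) (negPf j'T) !inE => mom.
case/or3P => /eqP e1; rewrite e1 in mom netE *.
- by move=> _; lia.
- move=> _; have jj : j' = - j by lia.
  exists (inr true); first by apply: sep; right; lia.
  by rewrite netE// jj abszN eqxx.
- by move=> /(_ erefl); lia.
Qed.

(** Once some isolated net coefficient is a nonzero integer, 1 <= C * M for the
    maximum M of the derivatives. The additive error 2 in
    |l_a| <= |net coefficient| + 2 is then absorbed in 2 * C * M, which explains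
    the factor 3. *)
Lemma combination_bound (R : realType) (g gamma : R) (h : \bar R)
    (kappa1 kappa2 : R) (nu : nat) (jv : 'I_nu -> int) :
  0 < g -> (0 < h)%E -> 0 < kappa1 -> kappa1 <= kappa2 -> (0 < nu)%N ->
  (forall a, jv a != 0) -> injective (fun a => `|jv a|%N) ->
  exists2 C : R, 0 < C &
    forall (l : 'rV[int]_nu) (e e' j j' : int) (i0 : 'I_nu + bool) (kappa : R),
      (`|e| <= 1)%R -> (`|e'| <= 1)%R -> j != 0 -> j' != 0 ->
      isolated_term jv j j' i0 ->
      net_coef jv l e e' j j' `|term_site jv j j' i0|%N != 0 ->
      kappa1 <= kappa <= kappa2 ->
      bracket R l <= C * maxderiv (nu + 2).+1
        (fun x => OmegaDot g gamma h jv l x + e%:~R * Omega g gamma h j x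
                  + e'%:~R * Omega g gamma h j' x) kappa.
Proof.
move=> g0 h0 k10 k12 nu0 jv0 inj.
have [C C0 hC] := net_coefficient_bound gamma ('I_nu + bool)%type
  (codom (fun a => `|jv a|%N)) g0 h0 k10 k12.
exists (nu%:R * (3 * C)); first by rewrite !mulr_gt0// ltr0n.
move=> l e e' j j' i0 kappa he he' j0 j'0 iso net hk.
pose site := term_site jv j j'; pose k := term_coef l e e'.
have site0 i : site i != 0 by rewrite /site; case: i => [a|[]] /=.
pose E : R := \sum_i (k i)%:~R * (gamma / 2 * (G0 h (site i) / (site i)%:~R)).
have FE : (fun x => OmegaDot g gamma h jv l x + e%:~R * Omega g gamma h j x
                  + e'%:~R * Omega g gamma h j' x) =
  (fun x => E + \sum_i (k i)%:~R * (disp_amp h `|site i|%N *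
     Num.sqrt (x + disp_shift g gamma h `|site i|%N))).
  apply/funext => x; rewrite -big_split/=.
  under [RHS]eq_bigr => i _ do rewrite -mulrDr addrC -Omega_split//.
  rewrite big_sumType big_bool/= addrA; congr (_ + _ + _).
  by apply: eq_bigr => a _; rewrite mulrC.
rewrite FE; have := hC E k (fun i => `|site i|%N).
rewrite card_sum card_ord card_bool; set M := maxderiv _ _ _ => {}hC.
have hnet i : isolated_term jv j j' i ->
    `|net_coef jv l e e' j j' `|site i|%N|%:~R <= C * M.
  by move=> hi; apply: hC => // i'; rewrite absz_gt0.
have CM1 : 1 <= C * M.
  by apply: le_trans (hnet _ iso); rewrite ler1z -gtz0_ge1 normr_gt0.
rewrite -!mulrA; apply: bracket_le => //; first by lra.
move=> a.
have isoa : isolated_term jv j j' (inl a).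
  by move=> i; apply: Or32; exact: codom_f.
have := hnet _ isoa; rewrite net_coef_site//.
set w := (X in _ + X); have hw : `|w| <= 2.
  by rewrite /w; case: ifP => _; case: ifP => _; lia.
have : `|l 0 a| <= `|l 0 a + w| + 2 by lia.
rewrite -(ler_int R) rmorphD/= => h1 h2; lra.
Qed.

Theorem proposition4p5 (R : realType) (g gamma : R) (h : \bar R)
    (kappa1 kappa2 : R) (nu : nat) (nbar : 'I_nu -> nat) (sigma : 'I_nu -> int)
    (g_gt0 : 0 < g) (h_gt0 : (0 < h)%E)
    (kappa1_gt0 : 0 < kappa1) (kappa12 : kappa1 < kappa2)
    (nu_gt0 : (0 < nu)%N)
    (nbar_ge1 : forall a : 'I_nu, (1 <= nbar a)%N)
    (nbar_incr : forall a b : 'I_nu, (a < b)%N -> (nbar a < nbar b)%N)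
    (sigma_sign : forall a : 'I_nu, sigma a = -1 \/ sigma a = 1) :
  let jv := jbar nbar sigma in
  let Om := Omega g gamma h in
  let Omv := OmegaDot g gamma h jv in
  exists (m0 : nat) (rho0 : R), 0 < rho0 /\
    forall kappa : R, kappa1 <= kappa <= kappa2 ->
    [/\ (forall l : 'rV[int]_nu, l <> 0 ->
           maxderiv m0 (fun k => Omv l k) kappa >= rho0 * bracket R l),
        (forall (l : 'rV[int]_nu) (j : int),
           normal0 jv j -> momentum jv l + j = 0 ->
           maxderiv m0 (fun k => Omv l k + Om j k) kappa
             >= rho0 * bracket R l),
        (forall (l : 'rV[int]_nu) (j j' : int),
           normal0 jv j -> normal0 jv j' -> (l, j, j') <> (0, j, j) ->
           momentum jv l + j - j' = 0 ->
           maxderiv m0 (fun k => Omv l k + Om j k - Om j' k) kappa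
             >= rho0 * bracket R l)
      & (forall (l : 'rV[int]_nu) (j j' : int),
           normal0 jv j -> normal0 jv j' ->
           momentum jv l + j + j' = 0 ->
           maxderiv m0 (fun k => Omv l k + Om j k + Om j' k) kappa
             >= rho0 * bracket R l)].
Proof.
move=> jv Om Omv.
have jv_abs a : `|jv a|%N = nbar a.
  by rewrite /jv /jbar; case: (sigma_sign a) => ->; lia.
have jv0 a : jv a != 0 by rewrite -absz_gt0 jv_abs.
have inj : injective (fun a => `|jv a|%N).
  move=> a b; rewrite /= !jv_abs => ab; apply: val_inj.
  by case: (ltngtP a b) => // /nbar_incr; rewrite ab ltnn.
have [C C0 hC] := combination_bound gamma g_gt0 h_gt0 kappa1_gt0
  (ltW kappa12) nu_gt0 jv0 inj.
exists (nu + 2).+1, C^-1; split; first by rewrite invr_gt0.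
move=> kappa hk.
have normal_neq0 j : normal0 jv j -> j != 0.
  by move=> nj; apply/eqP => j0; apply: nj; right.
(* The last three estimates are the cases e' = 0, -1, 1. *)
have resonance l j j' e' : normal0 jv j -> normal0 jv j' ->
    e' \in [:: 0; 1; -1] -> (e' = -1 -> j = j' -> l <> 0) ->
    momentum jv l + j + e' * j' = 0 ->
    C^-1 * bracket R l <= maxderiv (nu + 2).+1
      (fun k => Omv l k + Om j k + e'%:~R * Om j' k) kappa.
  move=> nj nj' he' hl mom; rewrite ler_pdivrMl//.
  have [i0 iso net] := nonresonant_index inj nj nj' he' hl mom.
  have e'1 : `|e'| <= 1 by move: he'; rewrite !inE => /or3P[] /eqP ->.
  have := hC l 1 e' j j' i0 kappa (lexx _) e'1 (normal_neq0 j nj)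
    (normal_neq0 j' nj') iso net hk.
  by under [X in maxderiv _ X _]eq_fun do rewrite mul1r.
split.
- move=> l /eqP l0; rewrite ler_pdivrMl//.
  have [a la] : exists a, l 0 a != 0.
    apply/not_existsP => la; case/eqP: l0; apply/rowP => a; rewrite mxE.
    exact/eqP/negPn/negP/la.
  (* With e = e' = 0 any nonzero integer can stand for j and j'. *)
  have iso : isolated_term jv 1 1 (inl a).
    by move=> i; apply: Or32; exact: codom_f.
  have := hC l 0 0 1 1 (inl a) kappa isT isT isT isT iso.
  rewrite net_coef_site// !if_same !addr0 => /(_ la hk).
  by under [X in maxderiv _ X _]eq_fun do rewrite !mul0r !addr0.
- move=> l j nj mom.
  have := resonance l j j 0 nj nj isT.
  rewrite mul0r addr0 => /(_ _ mom).
  under [X in maxderiv _ X _]eq_fun do rewrite mul0r addr0.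
  by apply.
- move=> l j j' nj nj' ljj mom.
  have := resonance l j j' (-1) nj nj' isT.
  rewrite mulN1r => /(_ _ mom).
  under [X in maxderiv _ X _]eq_fun do rewrite mulrN1z mulN1r.
  by apply=> _ jj l0; apply: ljj; rewrite l0 jj.
- move=> l j j' nj nj' mom.
  have := resonance l j j' 1 nj nj' isT.
  rewrite mul1r => /(_ _ mom).
  by under [X in maxderiv _ X _]eq_fun do rewrite mul1r; apply.
Qed.
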